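(* Let $n\ge 3$ and let $(Q,+,\cdot,\le)$ be a Euclidean ordered field. Consider the formulas (using 4 variables) $$\Psi_{\lambda\to\sigma}(x,y):=\neg(x\,\lambda\,y)\wedge\exists z\big(x\,\lambda\,z\wedge\neg(y\,\lambda\,z)\wedge\neg\exists u\,(u\,\lambda\,x\wedge u\,\lambda\,y\wedge u\,\lambda\,z)\big),$$ $$\Psi_{\lambda\to\tau}(x,y):=\neg\Psi_{\lambda\to\sigma}(x,y)\wedge\neg(x\,\lambda\,y)\wedge x\neq y.$$ Then in the structure $(Q^n,\lambda)$, $\Psi_{\lambda\to\sigma}$ defines the relation $\sigma$ and $\Psi_{\lambda\to\tau}$ defines the relation $\tau$.
   Context: For $p=(p_0,\dots,p_{n-1}),\,q=(q_0,\dots,q_{n-1})\in Q^n$: $p\,\tau\,q$ iff $(p_0-q_0)^2>\sum_{i=1}^{n-1}(p_i-q_i)^2$; $p\,\lambda\,q$ iff $(p_0-q_0)^2=\sum_{i=1}^{n-1}(p_i-q_i)^2$ and $p_0\neq q_0$; $p\,\sigma\,q$ iff $(p_0-q_0)^2<\sum_{i=1}^{n-1}(p_i-q_i)^2$. An ordered field is Euclidean if every nonnegative element is a square. A formula $\varphi(x,y)$ defines relation $R$ in $(Q^n,\lambda)$ if for all $a,b\in Q^n$, $\varphi(a,b)$ holds (symbol $\lambda$ interpreted as the relation $\lambda$, quantifiers over $Q^n$) iff $(a,b)\in R$. *)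

(* Defs.v *)
From mathcomp Require Import all_boot all_order all_algebra.

Set Implicit Arguments.
Unset Strict Implicit.
Unset Printing Implicit Defensive.

Import Order.TTheory GRing.Theory Num.Theory.
Local Open Scope ring_scope.

Definition euclidean (Q : realFieldType) : Prop :=
  forall a : Q, 0 <= a -> exists b : Q, a = b ^+ 2.

(* The dimension is written m.+1 so that the time coordinate has index ord0. *)
Section CausalRelations.
Variables (Q : realFieldType) (m : nat).
Implicit Types p q : 'rV[Q]_m.+1.

Definition time_sq p q : Q := (p 0 ord0 - q 0 ord0) ^+ 2.

Definition space_sq p q : Q :=
  \sum_(i < m.+1 | i != ord0) (p 0 i - q 0 i) ^+ 2.

Definition timelike : rel 'rV[Q]_m.+1 :=
  fun p q => time_sq p q > space_sq p q.

Definition lightlike : rel 'rV[Q]_m.+1 :=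
  fun p q => (time_sq p q == space_sq p q) && (p 0 ord0 != q 0 ord0).

Definition spacelike : rel 'rV[Q]_m.+1 :=
  fun p q => time_sq p q < space_sq p q.

End CausalRelations.

(* First-order formulas with equality over one binary relation symbol, using
   only the k variables indexed by 'I_k (which may be requantified). *)
Inductive formula (k : nat) : Type :=
  | AtomEq of 'I_k & 'I_k
  | AtomRel of 'I_k & 'I_k
  | Not of formula k
  | And of formula k & formula k
  | Exists of 'I_k & formula k.

Declare Scope fo_scope.
Delimit Scope fo_scope with fo.
Bind Scope fo_scope with formula.

Notation "~ f" := (Not f) : fo_scope.
Notation "f /\ g" := (And f g) : fo_scope.

Definition update (k : nat) (T : Type) (v : 'I_k -> T) (i : 'I_k) (t : T) :
    'I_k -> T :=
  fun j => if j == i then t else v j.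

Fixpoint holds (k : nat) (T : Type) (R : rel T) (v : 'I_k -> T)
    (f : formula k) : Prop :=
  match f with
  | AtomEq i j => v i = v j
  | AtomRel i j => R (v i) (v j)
  | Not g => ~ holds R v g
  | And g h => holds R v g /\ holds R v h
  | Exists i g => exists t : T, holds R (update v i t) g
  end.

(* f(x, y) defines S in the structure (T, R); ranging over all valuations also
   says that the truth of f depends on the values of x and y only. *)
Definition defines (k : nat) (T : Type) (R : rel T) (f : formula k)
    (x y : 'I_k) (S : rel T) : Prop :=
  forall v : 'I_k -> T, holds R v f <-> S (v x) (v y).

Definition var_x : 'I_4 := @Ordinal 4 0 isT.
Definition var_y : 'I_4 := @Ordinal 4 1 isT.
Definition var_z : 'I_4 := @Ordinal 4 2 isT.
Definition var_u : 'I_4 := @Ordinal 4 3 isT.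

Definition Psi_lightlike_spacelike : formula 4 :=
  (~ AtomRel var_x var_y /\
   Exists var_z
     (AtomRel var_x var_z /\ ~ AtomRel var_y var_z /\
      ~ Exists var_u
          (AtomRel var_u var_x /\ AtomRel var_u var_y /\ AtomRel var_u var_z)))%fo.

Definition Psi_lightlike_timelike : formula 4 :=
  (~ Psi_lightlike_spacelike /\ ~ AtomRel var_x var_y /\ ~ AtomEq var_x var_y)%fo.

(* Main.v *)
Require Import Defs.
From mathcomp Require Import all_boot all_order all_algebra.
From mathcomp Require Import ring lra.

(** Put [x] at the origin and use the Minkowski form [<.,.>]. If [z] is a nonzero
    null vector, any [u] lightlike related to both [0] and [z] is a multiple
    [t z], and [t z] is at null distance from [y] iff [<y,y> = 2 t <z,y>]. For
    timelike [y], [<z,y>] never vanishes, so a common [u] always exists unless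
    [y] and [z] are lightlike related. For spacelike [y], the choice of a null [z]
    orthogonal to [y] (possible in dimension at least 3 over a Euclidean field)
    leaves no such [u]. *)

Set Implicit Arguments.
Unset Strict Implicit.
Unset Printing Implicit Defensive.

Import Order.TTheory GRing.Theory Num.Theory.
Local Open Scope ring_scope.

Section Minkowski.
Variables (Q : realFieldType) (m : nat).
Implicit Types (u v w x y z : 'rV[Q]_m.+1) (a : Q).

(** * The Minkowski form and its bilinearity *)

Definition mink u v : Q :=
  u 0 ord0 * v 0 ord0 - \sum_(i < m.+1 | i != ord0) u 0 i * v 0 i.

Lemma minkC u v : mink u v = mink v u.
Proof. by rewrite /mink mulrC; under eq_bigr do rewrite mulrC. Qed.

Lemma minkDl u v w : mink (u + v) w = mink u w + mink v w.
Proof.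
rewrite /mink !mxE; under eq_bigr do rewrite !mxE mulrDl.
by rewrite big_split /=; ring.
Qed.

Lemma minkZl a u w : mink (a *: u) w = a * mink u w.
Proof.
rewrite /mink !mxE; under eq_bigr do rewrite !mxE -mulrA.
by rewrite -mulr_sumr; ring.
Qed.

Lemma minkDr u v w : mink w (u + v) = mink w u + mink w v.
Proof. by rewrite !(minkC w) minkDl. Qed.

Lemma minkZr a u w : mink w (a *: u) = a * mink w u.
Proof. by rewrite !(minkC w) minkZl. Qed.

Lemma minkNl u w : mink (- u) w = - mink u w.
Proof. by rewrite -scaleN1r minkZl mulN1r. Qed.

Lemma minkNr u w : mink w (- u) = - mink w u.
Proof. by rewrite !(minkC w) minkNl. Qed.

Definition minkE := (minkDl, minkDr, minkNl, minkNr, minkZl, minkZr).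

Lemma mink_delta0 v : mink v (delta_mx 0 ord0) = v 0 ord0.
Proof.
rewrite /mink mxE !eqxx mulr1 big1 ?subr0 // => i /negbTE i0.
by rewrite mxE i0 andbF mulr0.
Qed.

Lemma mink_delta v i : i != ord0 -> mink v (delta_mx 0 i) = - v 0 i.
Proof.
move=> i0; rewrite /mink mxE eqxx eq_sym (negbTE i0) mulr0 sub0r (bigD1 i) //=.
rewrite mxE !eqxx mulr1 big1 ?addr0 // => j /andP[_ /negbTE ji].
by rewrite mxE ji andbF mulr0.
Qed.

(** * Null vectors and orthogonality *)

Lemma mink_le0 w : w 0 ord0 = 0 -> mink w w <= 0.
Proof.
move=> w0; rewrite /mink w0 mul0r sub0r oppr_le0.
by apply: sumr_ge0 => i _; rewrite -expr2 sqr_ge0.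
Qed.

Lemma mink_eq0 w : w 0 ord0 = 0 -> mink w w = 0 -> w = 0.
Proof.
move=> w0 /eqP; rewrite /mink w0 mul0r sub0r oppr_eq0 psumr_eq0; last first.
  by move=> i _; rewrite -expr2 sqr_ge0.
move=> /allP ws; apply/rowP => i; rewrite mxE.
case: (eqVneq i ord0) => [-> //|i0].
have := ws i (mem_index_enum i); rewrite i0 /= mulf_eq0 orbb.
by move/eqP.
Qed.

(** This lets the clause on distinct time coordinates in [lightlike] be replaced by distinctness of
    the two points. *)
Lemma null_time_neq0 w : mink w w = 0 -> (w 0 ord0 != 0) = (w != 0).
Proof.
move=> ww; congr (~~ _); apply/eqP/eqP => [w0 | ->]; first exact: mink_eq0.
by rewrite mxE.
Qed.

(** Subtracting from [u] the multiple of [z] with the same time coordinate leaves a purely spatial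
    null vector, and the form is negative definite on spatial vectors. *)
Lemma null_orthogonal_collinear z u :
  z != 0 -> mink z z = 0 -> mink u u = 0 -> mink u z = 0 ->
  exists a, u = a *: z.
Proof.
move=> z0 zz uu uz; have t0 : z 0 ord0 != 0 by rewrite null_time_neq0.
exists (u 0 ord0 / z 0 ord0); apply/eqP; rewrite -subr_eq0; apply/eqP.
apply: mink_eq0; first by rewrite !mxE divfK // subrr.
by rewrite !minkE (minkC z u) uu uz zz; ring.
Qed.

Lemma null_timelike_neq0 z y :
  z != 0 -> mink z z = 0 -> 0 < mink y y -> mink z y != 0.
Proof.
move=> z0 zz yy; apply/eqP => zy.
have t0 : z 0 ord0 != 0 by rewrite null_time_neq0.
(* This combination is purely spatial, yet if [z] were orthogonal to [y] its square would be
   [z 0 ord0 ^+ 2 * mink y y], which is positive. *)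
have /mink_le0 : (z 0 ord0 *: y - y 0 ord0 *: z) 0 ord0 = 0.
  by rewrite !mxE mulrC subrr.
rewrite !minkE (minkC y z) zz zy; apply/negP; rewrite -ltNge.
have : 0 < z 0 ord0 ^+ 2 * mink y y by rewrite mulr_gt0 // exprn_even_gt0.
by congr (0 < _); ring.
Qed.

(* The spatial part of [z] combines that of [w] with a spatial vector [r]
   orthogonal to [w], which exists because there are two spatial directions. *)
Lemma spacelike_null_orthogonal w : (2 <= m)%N -> euclidean Q ->
  mink w w < 0 -> exists z, [/\ z != 0, mink z z = 0 & mink z w = 0].
Proof.
move=> m2 hQ ww.
have [i i0 wi] : exists2 i, i != ord0 & w 0 i != 0.
  case: (pickP (fun i => (i != ord0) && (w 0 i != 0))) => [i /andP[]|nw].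
    by exists i.
  move: ww; rewrite /mink big1 ?subr0; last first.
    by move=> i i0; move: (nw i); rewrite i0 => /negbFE/eqP->; rewrite mul0r.
  by rewrite -expr2 ltNge sqr_ge0.
have [j j0 ji] : exists2 j, j != ord0 & j != i.
  have /existsP[j] : [exists j, j \notin [set ord0; i]].
    rewrite -negb_forall; apply/negP => /forallP full.
    have := cardsT 'I_m.+1; have -> : [set: 'I_m.+1] = [set ord0; i].
      by apply/setP => j; rewrite in_setT full.
    by rewrite cards2 card_ord; case: (_ != _); case: m m2 => [|[]].
  by rewrite !inE negb_or => /andP[]; exists j.
pose e : 'rV[Q]_m.+1 := delta_mx 0 ord0.
pose t := w 0 ord0.
pose K := w 0 i ^+ 2 + w 0 j ^+ 2.
have [r [rr wr re]] : exists r, [/\ mink r r = - K, mink w r = 0 & mink r e = 0].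
  (* The ([i], [j])-part of [w], turned by a right angle. *)
  pose r : 'rV[Q]_m.+1 := w 0 i *: delta_mx 0 j - w 0 j *: delta_mx 0 i.
  exists r; split.
  - rewrite {2}/r !minkE !mink_delta // !mxE !eqxx (eq_sym i) (negbTE ji) /= /K.
    by ring.
  - by rewrite /r !minkE !mink_delta //; ring.
  - by rewrite mink_delta0 !mxE !(eq_sym ord0) (negbTE i0) (negbTE j0) /=; ring.
have ee : mink e e = 1 by rewrite mink_delta0 mxE !eqxx.
have we : mink w e = t by exact: mink_delta0.
have [er rw] : mink e r = 0 /\ mink r w = 0 by split; rewrite minkC.
have ew : mink e w = t by rewrite minkC.
have K0 : 0 < K by rewrite ltr_wpDr ?sqr_ge0 // exprn_even_gt0.
clearbody e K t.
have t2 : 0 <= t ^+ 2 by exact: sqr_ge0.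
(* [S] is the squared Euclidean length of the spatial part of [w]; it exceeds [t ^+ 2] because [w]
   is spacelike. *)
pose S := t ^+ 2 - mink w w.
have wwS : mink w w = t ^+ 2 - S by rewrite /S; ring.
have S0 : 0 < S by rewrite /S; lra.
have [b bE] : exists b, (1 - t ^+ 2 / S) / K = b ^+ 2.
  apply: hQ; rewrite divr_ge0 ?(ltW K0) // subr_ge0 ler_pdivrMr // mul1r /S.
  by lra.
clearbody S.
have Sn : S != 0 by rewrite gt_eqF.
have Kn : K != 0 by rewrite gt_eqF.
(* The time coordinate is 1, and the coefficient [t / S] makes the pairing with [w] vanish. The
   spatial component along [w] has squared length [t ^+ 2 / S], so [b *: r] must supply the
   remaining [1 - t ^+ 2 / S]. *)
exists (e + (t / S) *: (w - t *: e) + b *: r); split.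
- apply/eqP => z0.
  have : mink (e + (t / S) *: (w - t *: e) + b *: r) e = 1.
    by rewrite !minkE ee we re; ring.
  by rewrite z0 -(scale0r 0) minkZl mul0r => /esym/eqP; rewrite oner_eq0.
- rewrite !minkE ee we ew re er rw wr rr wwS.
  transitivity (1 - t ^+ 2 / S - b ^+ 2 * K); first by field.
  by rewrite -bE divfK // subrr.
- by rewrite !minkE ew rw wwS; field.
Qed.

(** * The causal relations in terms of the form *)

Lemma mink_subr u v :
  mink (u - v) (u - v) = mink u u - 2 * mink u v + mink v v.
Proof. by rewrite !minkE (minkC v u); ring. Qed.

Lemma time_space_mink x y :
  time_sq x y - space_sq x y = mink (x - y) (x - y).
Proof.
rewrite /time_sq /space_sq /mink !mxE -expr2; congr (_ - _).
by apply: eq_bigr => i _; rewrite !mxE expr2.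
Qed.

Lemma timelikeE x y : timelike x y = (0 < mink (x - y) (x - y)).
Proof. by rewrite -time_space_mink subr_gt0. Qed.

Lemma spacelikeE x y : spacelike x y = (mink (x - y) (x - y) < 0).
Proof. by rewrite -time_space_mink subr_lt0. Qed.

Lemma lightlikeE x y :
  lightlike x y = (mink (x - y) (x - y) == 0) && (x != y).
Proof.
rewrite /lightlike -subr_eq0 time_space_mink -(subr_eq0 x y).
case: eqP => //= /null_time_neq0 <-; by rewrite !mxE subr_eq0.
Qed.

(** * Points lightlike related to three given points *)

Lemma spacelike_no_common_lightlike x y : (2 <= m)%N -> euclidean Q ->
  spacelike x y ->
  exists z, [/\ lightlike x z, ~~ lightlike y z &
    forall u, lightlike u x -> lightlike u y -> ~~ lightlike u z].
Proof.
move=> m2 hQ; rewrite spacelikeE => xy.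
have [z [z0 zz zxy]] := spacelike_null_orthogonal m2 hQ xy.
have xz : x - (x - z) = z by rewrite opprB addrC subrK.
exists (x - z); split.
- by rewrite lightlikeE -(subr_eq0 x) xz zz eqxx.
- have -> : lightlike y (x - z) = lightlike z (x - y).
    by rewrite !lightlikeE -(subr_eq0 y) -(subr_eq0 z) !opprB addrCA.
  by rewrite lightlikeE mink_subr zz zxy mulr0 subr0 add0r lt_eqF.
- move=> u; rewrite !lightlikeE => /andP[/eqP ux _] /andP[/eqP uy _].
  apply/negP => /andP[/eqP uz _].
  have xu : mink (x - u) (x - u) = 0 by rewrite -(opprB u) minkNl minkNr opprK.
  have uzE : u - (x - z) = z - (x - u) by rewrite !opprB addrCA.
  have uyE : u - y = (x - y) - (x - u) by rewrite opprB [RHS]addrC addrA subrK.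
  have [|a uE] := null_orthogonal_collinear z0 zz xu.
    by move: uz; rewrite uzE mink_subr zz xu (minkC _ z); lra.
  (* As [x - u] is a multiple of [z], it is null and orthogonal to [x - y], so [u - y] has the same
     negative square as [x - y]. *)
  move: uy; rewrite uyE mink_subr xu uE minkZr (minkC _ z) zxy.
  by move: xy; lra.
Qed.

Lemma nonspacelike_common_lightlike x y z :
  ~~ spacelike x y -> ~~ lightlike x y -> lightlike x z -> ~~ lightlike y z ->
  exists u, [/\ lightlike u x, lightlike u y & lightlike u z].
Proof.
have [<- _ _ -> //|nxy] := eqVneq x y.
rewrite spacelikeE !lightlikeE nxy andbT -leNgt -(subr_eq0 x z) => ge0 ne0.
move=> /andP[/eqP zz z0] yz.
have yy : 0 < mink (x - y) (x - y) by rewrite lt_neqAle eq_sym ne0.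
have := null_timelike_neq0 z0 zz yy.
set a := mink (x - y) (x - y) / (2 * mink (x - z) (x - y)) => zy.
have a0 : a != 0 by rewrite mulf_neq0 ?invr_eq0 ?mulf_neq0 ?pnatr_eq0.
have uy : mink (x - a *: (x - z) - y) (x - a *: (x - z) - y) = 0.
  rewrite (addrAC x) mink_subr !minkZr !minkZl zz (minkC _ (x - z)) /a.
  by field.
have ux : x - a *: (x - z) - x = - (a *: (x - z)) by rewrite addrAC subrr add0r.
have uz : x - a *: (x - z) - z = (1 - a) *: (x - z).
  by rewrite addrAC scalerBl scale1r.
(* If [u] were [y], then [x - y] would be a multiple of the null vector [x - z], hence null
   itself. *)
have uxN : x - a *: (x - z) != y.
  apply/eqP => uyE; move: ne0.
  have -> : x - y = a *: (x - z) by rewrite -uyE opprB addrC subrK.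
  by rewrite minkZl minkZr zz !mulr0 eqxx.
exists (x - a *: (x - z)); rewrite !lightlikeE uy uxN eqxx; split=> //.
  rewrite -(subr_eq0 _ x) ux oppr_eq0 scaler_eq0 negb_or a0 z0.
  by rewrite !(minkNl, minkNr, minkZl, minkZr) zz !(mulr0, oppr0) eqxx.
rewrite -(subr_eq0 _ z) uz scaler_eq0 negb_or z0 !(minkZl, minkZr) zz !mulr0 eqxx.
(* If [a] were 1, then [u] would be [z], making [z] lightlike related to [y]. *)
rewrite andbT subr_eq0; apply: contraNneq yz => a1.
move: uz uxN uy; rewrite -a1 subrr scale0r => /eqP; rewrite subr_eq0 => /eqP->.
by rewrite -(opprB y) minkNl minkNr opprK eq_sym => -> ->; rewrite eqxx.
Qed.

Lemma spacelike_not_lightlike x y : spacelike x y -> ~~ lightlike x y.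
Proof. by rewrite spacelikeE lightlikeE => /lt_eqF ->. Qed.

Lemma timelike_complement x y :
  timelike x y = [&& ~~ spacelike x y, ~~ lightlike x y & x != y].
Proof.
rewrite timelikeE spacelikeE lightlikeE.
have [<-|nxy] := eqVneq x y.
  by rewrite subrr -(scale0r 0) minkZl mul0r ltxx andbF.
by case: ltgtP.
Qed.

(** * Definability of the two relations *)

Lemma defines_spacelike : (2 <= m)%N -> euclidean Q ->
  defines (@lightlike Q m) Psi_lightlike_spacelike var_x var_y (@spacelike Q m).
Proof.
move=> m2 hQ v; rewrite /= /update /=.
move: (v var_x) (v var_y) => x y; split.
  case=> /negP nxy [z [xz [/negP yz nu]]].
  apply: contra_notT nu => nsp.
  have [u [ux uy uz]] := nonspacelike_common_lightlike nsp nxy xz yz.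
  by exists u.
move=> sxy; split; first exact/negP/spacelike_not_lightlike.
have [z [xz yz nu]] := spacelike_no_common_lightlike m2 hQ sxy.
exists z; split=> //; split; first exact/negP.
by case=> u [ux [uy uz]]; have := nu u ux uy; rewrite uz.
Qed.

Lemma defines_timelike : (2 <= m)%N -> euclidean Q ->
  defines (@lightlike Q m) Psi_lightlike_timelike var_x var_y (@timelike Q m).
Proof.
move=> m2 hQ v; rewrite timelike_complement.
have [spP1 spP2] := defines_spacelike m2 hQ v.
split; first case=> nsp [/negP -> /eqP ->].
  by rewrite !andbT; apply/negP => /spP2.
case/and3P=> /negP nsp /negP nl /eqP ne.
by split=> [/spP1|] //; split.
Qed.

End Minkowski.

Theorem theorem3p3 (m : nat) (hn : (3 <= m.+1)%N)
    (Q : realFieldType) (hQ : euclidean Q) :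
  defines (@lightlike Q m) Psi_lightlike_spacelike var_x var_y (@spacelike Q m)
  /\
  defines (@lightlike Q m) Psi_lightlike_timelike var_x var_y (@timelike Q m).
Proof. by split; [exact: defines_spacelike | exact: defines_timelike]. Qed.
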